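(* Let $p>0$. The index $S_p$ is scale invariant: for every $N\ge 1$, every vector $Y=(Y_1,\dots,Y_N)$ with positive entries and every $\gamma>0$, one has $S_p(\gamma Y)=S_p(Y)$.
   Context: For a vector $Y=(Y_1,\dots,Y_N)$ with positive entries, let $r$ be a permutation of $\{1,\dots,N\}$ with $Y_{r_1}\le Y_{r_2}\le\dots\le Y_{r_N}$, and let $\bar Y=\frac1N\sum_{i=1}^N Y_i$. The Lorenz curve $L_Y:[0,1]\to\mathbb{R}$ is the piecewise linear interpolation of the points $\big(\frac kN,\sum_{i=1}^kY_{r_i}\big)$, $k=0,\dots,N$, and the dual Lorenz curve $L_Y^c:[0,1]\to\mathbb{R}$ is the piecewise linear interpolation of the points $\big(\frac kN,\sum_{i=1}^kY_{r_{N+1-i}}\big)$, $k=0,\dots,N$. For $p>0$, $$S_p(Y)=\frac{1}{N\bar Y}\Big(\int_0^1|L_Y^c(t)-L_Y(t)|^p\,dt\Big)^{1/p}.$$ *)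

(* Defs.v *)
From HB Require Import structures.
From mathcomp Require Import all_boot all_order all_algebra all_fingroup.
From mathcomp Require Import all_classical all_reals all_analysis.

Set Implicit Arguments.
Unset Strict Implicit.
Unset Printing Implicit Defensive.

Import Order.TTheory GRing.Theory Num.Theory.
Import numFieldNormedType.Exports.

Local Open Scope ring_scope.

Definition is_sorting (R : realType) (N : nat) (Y : 'rV[R]_N) (r : 'S_N) : bool :=
  [forall i : 'I_N, forall j : 'I_N, (i <= j)%N ==> (Y 0 (r i) <= Y 0 (r j))].

Lemma is_sorting_ex (R : realType) (N : nat) (Y : 'rV[R]_N) :
  exists r : 'S_N, is_sorting Y r.
Proof.
pose s := sort <=%R (codom (Y 0)).
have sz : size s == N by rewrite size_sort size_codom card_ord.
have /tuple_permP[r sE] : perm_eq (Tuple sz) [tuple Y 0 i | i < N].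
  by rewrite /= perm_sort /= /codom /image_mem.
exists r; apply/forallP => i; apply/forallP => j; apply/implyP => ij.
have E (k : 'I_N) : Y 0 (r k) = nth 0 s k.
  transitivity (tnth (Tuple sz) k); last by rewrite (tnth_nth 0).
  by rewrite (tnth_nth 0) sE -tnth_nth !tnth_mktuple.
rewrite !E; apply: (sorted_leq_nth (leT := <=%R)) => //.
- exact: le_trans.
- exact: sort_le_sorted.
- by rewrite inE (eqP sz).
- by rewrite inE (eqP sz).
Qed.

(* Ties in [Y] make the permutation non-unique; the sorted values
   [Y 0 (r i)], hence the curves below, do not depend on the choice
   ([is_sorting_uniq]). *)
Definition sort_perm (R : realType) (N : nat) (Y : 'rV[R]_N) : 'S_N :=
  xchoose (is_sorting_ex Y).

Lemma sort_permP (R : realType) (N : nat) (Y : 'rV[R]_N) :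
  is_sorting Y (sort_perm Y).
Proof. exact: xchooseP. Qed.

Lemma is_sorting_uniq (R : realType) (N : nat) (Y : 'rV[R]_N) (r r' : 'S_N) :
  is_sorting Y r -> is_sorting Y r' -> forall i, Y 0 (r i) = Y 0 (r' i).
Proof.
have S (q : 'S_N) : is_sorting Y q -> sorted <=%R [tuple Y 0 (q i) | i < N].
  move=> /forallP h; apply/(sortedP 0) => i; rewrite size_tuple => iN.
  have iN' : (i < N)%N by exact: ltnW.
  rewrite -(tnth_nth 0 _ (Ordinal iN)) -(tnth_nth 0 _ (Ordinal iN')).
  rewrite !tnth_mktuple.
  by have /forallP/(_ (Ordinal iN))/implyP := h (Ordinal iN'); apply.
have P (q : 'S_N) : perm_eq [tuple Y 0 (q i) | i < N] [tuple Y 0 i | i < N].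
  apply/tuple_permP; exists q; congr val; apply: eq_from_tnth => i.
  by rewrite !tnth_mktuple.
move=> /S h /S h' i.
have E : [tuple Y 0 (r i) | i < N] = [tuple Y 0 (r' i) | i < N].
  apply: val_inj; apply: (sorted_eq le_trans le_anti h h').
  by rewrite (perm_trans (P r)) // perm_sym P.
by have := congr1 (fun t => tnth t i) E; rewrite !tnth_mktuple.
Qed.

Definition mean (R : realType) (N : nat) (Y : 'rV[R]_N) : R :=
  N%:R^-1 * \sum_(i < N) Y 0 i.

(* Piecewise linear interpolation on [0, 1] of the points [(k / N, v k)],
   k = 0, ..., N.  On the cell [k / N <= t < (k + 1) / N], [k] is the integer
   part of [N t]; at [t = 1] we have [k = N] and the slope term vanishes, so
   the value of [v] at [N + 1] is irrelevant. *)
Definition pl_interp (R : realType) (N : nat) (v : nat -> R) (t : R) : R :=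
  let k := Num.truncn (N%:R * t) in
  v k + (N%:R * t - k%:R) * (v k.+1 - v k).

Lemma pl_interpE (R : realType) (N : nat) (v : nat -> R) (k : nat) (t : R) :
  (k < N)%N -> k%:R / N%:R <= t <= k.+1%:R / N%:R ->
  pl_interp N v t = v k + (t - k%:R / N%:R) / N%:R^-1 * (v k.+1 - v k).
Proof.
move=> kN; have N0 : 0 < N%:R :> R by rewrite ltr0n (leq_ltn_trans _ kN).
rewrite ler_pdivrMr // ler_pdivlMr // [t * _]mulrC => /andP[kt tk].
rewrite invrK mulrBl divfK ?gt_eqF // [t * _]mulrC /pl_interp.
have [tk'|tk'] := ltP (N%:R * t) k.+1%:R.
  suff -> : Num.truncn (N%:R * t) = k by [].
  by apply: truncn_def; rewrite kt.
have -> : N%:R * t = k.+1%:R by apply/eqP; rewrite eq_le tk.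
rewrite natrK subrr mul0r addr0 -natr1 addrAC subrr add0r mul1r.
by rewrite addrC subrK.
Qed.

(* With 0-based indices, [rev_ord i] is [N - 1 - i]. *)
Definition lorenz (R : realType) (N : nat) (Y : 'rV[R]_N) : R -> R :=
  pl_interp N (fun k => \sum_(i < N | (i < k)%N) Y 0 (sort_perm Y i)).

Definition dual_lorenz (R : realType) (N : nat) (Y : 'rV[R]_N) : R -> R :=
  pl_interp N (fun k => \sum_(i < N | (i < k)%N) Y 0 (sort_perm Y (rev_ord i))).

Definition S_index (R : realType) (p : R) (N : nat) (Y : 'rV[R]_N) : R :=
  (N%:R * mean Y)^-1 *
  (\int[@lebesgue_measure R]_(t in `[0, 1]%classic)
     (`|dual_lorenz Y t - lorenz Y t| `^ p)) `^ p^-1.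

(* Main.v *)
Require Import Defs.
From mathcomp Require Import all_boot all_order all_algebra all_fingroup.
From mathcomp Require Import all_classical all_reals all_analysis.
From mathcomp Require Import measurable_realfun.
Import Order.TTheory GRing.Theory Num.Theory.
Local Open Scope ring_scope.

Lemma measurable_truncn (R : realType) :
  measurable_fun [set: R] (fun x : R => Num.truncn x).
Proof.
have mR : measurable_fun [set: R] (fun x : R => (Num.truncn x)%:R : R).
  apply: nondecreasing_measurable => // x y xy.
  by rewrite ler_nat le_truncn.
move=> _ A _; rewrite setTI.
(* Any set of naturals is a countable union of points, so the level sets of the monotone real-valued
   map suffice. *)
have -> : ((fun x : R => Num.truncn x) @^-1` A = \bigcup_(k in A)
    (fun x : R => (Num.truncn x)%:R : R) @^-1` [set k%:R])%classic.
  apply/seteqP; split => [x Ax|x [k Ak] /= /eqP].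
    by exists (Num.truncn x).
  by rewrite eqr_nat => /eqP ->.
apply: bigcup_measurable => k _.
by rewrite -[X in measurable X]setTI; exact: mR.
Qed.

Lemma measurable_pl_interp (R : realType) (N : nat) (v : nat -> R) :
  measurable_fun [set: R] (pl_interp N v).
Proof.
have mN : measurable_fun [set: R] (fun t : R => N%:R * t).
  exact: measurable_funM.
(* Every [w] is measurable, since [nat] carries the discrete sigma-algebra. *)
have mk (w : nat -> R) :
    measurable_fun [set: R] (fun t : R => w (Num.truncn (N%:R * t))).
  apply: (@measurableT_comp _ _ _ _ _ _ w) => //.
  exact: (measurableT_comp (@measurable_truncn R) mN).
rewrite /pl_interp; apply: measurable_funD; first exact: mk.
apply: measurable_funM.
  exact: measurable_funB (mk (fun k => k%:R)).
exact: mk (fun k => v k.+1 - v k).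
Qed.

Lemma pl_interpZ (R : realType) (N : nat) (c : R) (v : nat -> R) (t : R) :
  pl_interp N (fun k => c * v k) t = c * pl_interp N v t.
Proof. by rewrite /pl_interp -mulrBr mulrCA -mulrDr. Qed.

Lemma is_sortingZ (R : realType) (N : nat) (Y : 'rV[R]_N) (c : R) (r : 'S_N) :
  0 < c -> is_sorting (c *: Y) r = is_sorting Y r.
Proof.
by move=> c0; do 2!(apply: eq_forallb => ?); rewrite !mxE ler_pM2l.
Qed.

(** With ties, the permutations chosen for [Y] and [c *: Y] may differ; both sort [Y], so they list
    the same values. *)
Lemma sort_permZ (R : realType) (N : nat) (Y : 'rV[R]_N) (c : R) :
  0 < c -> forall i,
  (c *: Y) 0 (sort_perm (c *: Y) i) = c * Y 0 (sort_perm Y i).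
Proof.
move=> c0 i; rewrite mxE; congr (c * _); apply: is_sorting_uniq.
  by have := sort_permP (c *: Y); rewrite is_sortingZ.
exact: sort_permP.
Qed.

Lemma lorenzZ (R : realType) (N : nat) (Y : 'rV[R]_N) (c t : R) :
  0 < c -> lorenz (c *: Y) t = c * lorenz Y t.
Proof.
move=> c0; rewrite /lorenz -pl_interpZ; congr (pl_interp _ _ _).
by apply/funext => k; rewrite mulr_sumr; apply: eq_bigr => i _; rewrite sort_permZ.
Qed.

Lemma dual_lorenzZ (R : realType) (N : nat) (Y : 'rV[R]_N) (c t : R) :
  0 < c -> dual_lorenz (c *: Y) t = c * dual_lorenz Y t.
Proof.
move=> c0; rewrite /dual_lorenz -pl_interpZ; congr (pl_interp _ _ _).
by apply/funext => k; rewrite mulr_sumr; apply: eq_bigr => i _; rewrite sort_permZ.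
Qed.

Lemma meanZ (R : realType) (N : nat) (Y : 'rV[R]_N) (c : R) :
  mean (c *: Y) = c * mean Y.
Proof.
rewrite /mean mulrCA; congr (_ * _); rewrite mulr_sumr.
by apply: eq_bigr => i _; rewrite mxE.
Qed.

(** Nonnegativity stands in for integrability: the identity is first taken in the extended reals. *)
Lemma ge0_RintegralZl (d : measure_display) (T : measurableType d)
  (R : realType) (mu : {measure set T -> \bar R}) (D : set T) (f : T -> R)
  (c : R) :
  measurable D -> measurable_fun D f -> (forall x, D x -> 0 <= f x) -> 0 < c ->
  \int[mu]_(x in D) (c * f x) = c * \int[mu]_(x in D) f x.
Proof.
move=> mD mf f0 c0; rewrite /Rintegral.
under eq_integral do rewrite EFinM.
rewrite ge0_integralZl ?lee_fin ?ltW//; last exact/measurable_EFinP.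
(* [fine] maps infinite values to 0, so both sides vanish in those cases. *)
case: (integral _ _ _) => [r//||].
  by rewrite gt0_muley ?lte_fin//= mulr0.
by rewrite gt0_muleNy ?lte_fin//= mulr0.
Qed.

Theorem proposition2 (R : realType) (p : R) (hp : 0 < p)
  (N : nat) (hN : (1 <= N)%N) (Y : 'rV[R]_N) (hY : forall i : 'I_N, 0 < Y 0 i)
  (gamma : R) (hgamma : 0 < gamma) :
  S_index p (gamma *: Y) = S_index p Y.
Proof.
have g0 := ltW hgamma.
rewrite /S_index meanZ.
under [X in _ * X `^ _]eq_Rintegral => t _.
  rewrite lorenzZ// dual_lorenzZ// -mulrBr normrM gtr0_norm// powRM//.
  over.
rewrite ge0_RintegralZl ?powR_gt0//; last first.
  apply: measurable_funTS; apply: (measurableT_comp (measurable_powR p)).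
  apply: (measurableT_comp (@normr_measurable R setT)).
  by apply: measurable_funB; exact: measurable_pl_interp.
rewrite powRM ?powR_ge0//; last first.
  by apply: Rintegral_ge0 => t _; exact: powR_ge0.
(* The exponents [p] and [p^-1] multiply to 1, leaving [gamma] itself. *)
rewrite -powRrM divff ?gt_eqF// powRr1//.
by rewrite [N%:R * _]mulrCA invfM mulrACA mulVf ?gt_eqF// mul1r.
Qed.
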